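(* Let ${\bf\Phi}=(\Phi,\phi,\widetilde\phi):(\mathcal C,p)\to(\mathcal C',p')$ be a universe category functor. The family of morphisms $\psi(\Gamma):int(H(\Gamma))\to\Phi(int(\Gamma))$, $\Gamma\in CC(\mathcal C,p)$, is a natural isomorphism of functors $CC(\mathcal C,p)\to\mathcal C'$ $$\psi:H\circ int\to int\circ\Phi.$$
   Context: Conventions. Composition of morphisms and functors is written in diagrammatic order: for $f:X\to Y$, $g:Y\to Z$ the composite is $f\circ g:X\to Z$. $\amalg_{i\in I}A_i$ denotes the set of pairs $(i,a)$, $i\in I$, $a\in A_i$. All constructions below for $(\mathcal C,p)$ are applied also to $(\mathcal C',p')$. Universes. A universe in a category $\mathcal C$ is a morphism $p:\widetilde U\to U$ with a choice, for every $F:X\to U$, of a pullback square with vertex $(X;F)$ and projections $p_F:(X;F)\to X$, $Q(F):(X;F)\to\widetilde U$, $p_F\circ F=Q(F)\circ p$. A universe category $(\mathcal C,p)$ is a category with a universe $p$ and a chosen final object $pt$. The category (underlying a C-system) $CC(\mathcal C,p)$. Define recursively sets $Ob_n(\mathcal C,p)$ and functions $int:Ob_n(\mathcal C,p)\to Ob(\mathcal C)$: $Ob_0(\mathcal C,p)=\{tt\}$, $int(tt)=pt$; $Ob_{n+1}(\mathcal C,p)=\amalg_{A\in Ob_n(\mathcal C,p)}Mor_{\mathcal C}(int(A),U)$, $int(A,F)=(int(A);F)$. Objects of $CC(\mathcal C,p)$ are pairs $\Gamma=(n,A)$ with $A\in Ob_n(\mathcal C,p)$, and $int(\Gamma)=int(A)$.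 Morphisms $\Gamma'\to\Gamma$ are (copies of) the morphisms $int(\Gamma')\to int(\Gamma)$ of $\mathcal C$, so that $int:CC(\mathcal C,p)\to\mathcal C$ is a fully faithful functor. Universe category functors. A universe category functor ${\bf\Phi}=(\Phi,\phi,\widetilde\phi):(\mathcal C,p)\to(\mathcal C',p')$ (with $p:\widetilde U\to U$, $p':\widetilde U'\to U'$) consists of a functor $\Phi:\mathcal C\to\mathcal C'$ and morphisms $\phi:\Phi(U)\to U'$, $\widetilde\phi:\Phi(\widetilde U)\to\widetilde U'$ such that $\Phi(pt)$ is final, $\Phi$ takes the chosen pullback squares of the universe $p$ to pullback squares, and the square $\widetilde\phi\circ p'=\Phi(p)\circ\phi$ is a pullback. The homomorphism $H:CC(\mathcal C,p)\to CC(\mathcal C',p')$ and the isomorphisms $\psi(\Gamma)$: on objects $H(n,A)=(n,H_n(A))$ and $\psi(n,A)=\psi_n(A)$, where $H_0(tt)=tt$, $\psi_0(tt):pt'\to\Phi(pt)$ is the unique morphism, $H_{n+1}(A,F)=(H_n(A),\psi_n(A)\circ\Phi(F)\circ\phi)$, and $\psi_{n+1}(A,F)$ is the unique morphism $int(H_{n+1}(A,F))\to\Phi(int(A,F))$ with $\psi_{n+1}(A,F)\circ\Phi(Q(F))\circ\widetilde\phi=Q(\psi_n(A)\circ\Phi(F)\circ\phi)$ and $\psi_{n+1}(A,F)\circ\Phi(p_F)=p_{\psi_n(A)\circ\Phi(F)\circ\phi}\circ\psi_n(A)$; each $\psi_n(A)$ is an isomorphism. On morphisms $f:\Gamma'\to\Gamma$,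 $H(f):H(\Gamma')\to H(\Gamma)$ is the unique morphism with $int(H(f))=\psi(\Gamma')\circ\Phi(int(f))\circ\psi(\Gamma)^{-1}$; this makes $H$ a functor. *)

(* Defs.v *)
From Stdlib Require Import ClassicalEpsilon.

Set Implicit Arguments.
Unset Strict Implicit.
Unset Printing Implicit Defensive.

Record category : Type := Category {
  ob :> Type;
  Hom : ob -> ob -> Type;
  idm : forall X, Hom X X;
  comp : forall X Y Z, Hom X Y -> Hom Y Z -> Hom X Z;
  comp_id_l : forall X Y (f : Hom X Y), comp (idm X) f = f;
  comp_id_r : forall X Y (f : Hom X Y), comp f (idm Y) = f;
  comp_assoc : forall X Y Z W (f : Hom X Y) (g : Hom Y Z) (h : Hom Z W),
    comp f (comp g h) = comp (comp f g) h
}.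

Arguments Hom {c} _ _.
Arguments idm {c} X.
Arguments comp {c X Y Z} _ _.

(** Diagrammatic order: [f ;; g] is first [f], then [g]. *)
Notation "f ;; g" := (comp f g) (at level 40, left associativity).

Record functor (C D : category) : Type := Functor {
  fob :> C -> D;
  fmor : forall X Y : C, Hom X Y -> Hom (fob X) (fob Y);
  fmor_id : forall X : C, fmor (idm X) = idm (fob X);
  fmor_comp : forall (X Y Z : C) (f : Hom X Y) (g : Hom Y Z),
    fmor (f ;; g) = fmor f ;; fmor g
}.

Arguments fmor {C D} _ {X Y} _.

(** Also in diagrammatic order: first [F], then [G]. *)
Definition comp_functor (C D E : category) (F : functor C D) (G : functor D E)
  : functor C E.
Proof.
  refine (@Functor C E (fun X => G (F X)) (fun X Y f => fmor G (fmor F f)) _ _).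
  - intros X. now rewrite !fmor_id.
  - intros X Y Z f g. now rewrite !fmor_comp.
Defined.

Section Basics.
Context {C : category}.

Definition is_iso {X Y : C} (f : Hom X Y) : Prop :=
  exists g : Hom Y X, f ;; g = idm X /\ g ;; f = idm Y.

Definition inverse {X Y : C} (f : Hom X Y) (hf : is_iso f) : Hom Y X :=
  proj1_sig (constructive_indefinite_description _ hf).

Lemma comp_inverse {X Y : C} (f : Hom X Y) (hf : is_iso f) :
  f ;; inverse hf = idm X.
Proof.
  unfold inverse.
  now destruct (constructive_indefinite_description _ hf) as [g [Hg Hg']].
Qed.

Lemma inverse_comp {X Y : C} (f : Hom X Y) (hf : is_iso f) :
  inverse hf ;; f = idm Y.
Proof.
  unfold inverse.
  now destruct (constructive_indefinite_description _ hf) as [g [Hg Hg']].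
Qed.

Definition is_final (X : C) : Prop := forall Y : C, exists! f : Hom Y X, True.

(** The square
<<
      W --g--> Y
      |        |
      f        k
      v        v
      X --h--> Z
>>
*)
Definition is_pullback {W X Y Z : C}
    (f : Hom W X) (g : Hom W Y) (h : Hom X Z) (k : Hom Y Z) : Prop :=
  f ;; h = g ;; k /\
  forall (T : C) (a : Hom T X) (b : Hom T Y), a ;; h = b ;; k ->
    exists! t : Hom T W, t ;; f = a /\ t ;; g = b.

End Basics.

Definition the {T : Type} {P : T -> Prop} (h : exists! x, P x) : T :=
  proj1_sig (constructive_indefinite_description _ h).

Lemma the_spec {T : Type} {P : T -> Prop} (h : exists! x, P x) : P (the h).
Proof.
  unfold the.
  now destruct (constructive_indefinite_description _ h) as [x [Px Hx]].
Qed.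

Definition is_nat_iso (C D : category) (F G : functor C D)
    (a : forall X : C, Hom (F X) (G X)) : Prop :=
  (forall (X Y : C) (f : Hom X Y), fmor F f ;; a Y = a X ;; fmor G f) /\
  (forall X : C, is_iso (a X)).

Arguments is_nat_iso {C D} F G a.

Lemma pullback_paste (C : category) (W X Y Z Y' Z' : C)
    (f : Hom W X) (g : Hom W Y) (h : Hom X Z) (k : Hom Y Z)
    (g' : Hom Y Y') (h' : Hom Z Z') (k' : Hom Y' Z') :
  is_pullback f g h k -> is_pullback k g' h' k' ->
  is_pullback f (g ;; g') (h ;; h') k'.
Proof.
  intros [E1 P1] [E2 P2]; split.
  - now rewrite comp_assoc, E1, <- !comp_assoc, E2.
  - intros T a b Hab.
    destruct (P2 T (a ;; h) b) as [u [[Hu1 Hu2] Uu]].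
    { now rewrite <- comp_assoc. }
    destruct (P1 T a u) as [t [[Ht1 Ht2] Ut]].
    { now symmetry. }
    exists t; split; [split|].
    + exact Ht1.
    + now rewrite comp_assoc, Ht2.
    + intros t' [H1 H2]. apply Ut. split; [exact H1|].
      symmetry; apply Uu; split.
      * now rewrite <- comp_assoc, <- E1, comp_assoc, H1.
      * now rewrite <- comp_assoc.
Qed.

Lemma pullback_ext (C : category) (W X Y Z T : C)
    (f : Hom W X) (g : Hom W Y) (h : Hom X Z) (k : Hom Y Z) (s t : Hom T W) :
  is_pullback f g h k -> s ;; f = t ;; f -> s ;; g = t ;; g -> s = t.
Proof.
  intros [E P] Hf Hg.
  destruct (P T (t ;; f) (t ;; g)) as [u [_ Hu]].
  { now rewrite <- !comp_assoc, E. }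
  transitivity u; [symmetry|]; apply Hu; now split.
Qed.

Lemma pullback_iso (C : category) (V W X' X Y Z : C)
    (f' : Hom V X') (g' : Hom V Y) (i : Hom X' X)
    (f : Hom W X) (g : Hom W Y) (h : Hom X Z) (k : Hom Y Z) (t : Hom V W) :
  is_pullback f' g' (i ;; h) k -> is_pullback f g h k -> is_iso i ->
  t ;; f = f' ;; i -> t ;; g = g' -> is_iso t.
Proof.
  intros P' P [j [Hij Hji]] Hf Hg.
  destruct (proj2 P' W (f ;; j) g) as [s [[Hs1 Hs2] _]].
  { rewrite <- (proj1 P), <- (comp_assoc f j), (comp_assoc j i), Hji.
    now rewrite comp_id_l. }
  exists s; split.
  - apply (pullback_ext P'); rewrite <- comp_assoc, comp_id_l.
    + now rewrite Hs1, comp_assoc, Hf, <- comp_assoc, Hij, comp_id_r.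
    + now rewrite Hs2.
  - apply (pullback_ext P); rewrite <- comp_assoc, comp_id_l.
    + now rewrite Hf, comp_assoc, Hs1, <- comp_assoc, Hji, comp_id_r.
    + now rewrite Hg.
Qed.

Record universe (C : category) : Type := Universe {
  univ : C;
  univt : C;
  univ_p : Hom univt univ;
  ext : forall X : C, Hom X univ -> C;
  ext_p : forall (X : C) (F : Hom X univ), Hom (ext F) X;
  ext_Q : forall (X : C) (F : Hom X univ), Hom (ext F) univt;
  ext_pullback : forall (X : C) (F : Hom X univ),
    is_pullback (ext_p F) (ext_Q F) F univ_p
}.

Arguments univ {C} _.
Arguments univt {C} _.
Arguments univ_p {C} _.
Arguments ext {C} _ {X} F.
Arguments ext_p {C} _ {X} F.
Arguments ext_Q {C} _ {X} F.
Arguments ext_pullback {C} _ {X} F.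

Record universe_category : Type := UniverseCategory {
  uc_cat :> category;
  uc_univ :> universe uc_cat;
  uc_pt : uc_cat;
  uc_pt_final : is_final uc_pt
}.

Record universe_category_functor (C C' : universe_category) : Type :=
  UniverseCategoryFunctor {
  ucf_functor :> functor C C';
  ucf_phi : Hom (ucf_functor (univ C)) (univ C');
  ucf_phit : Hom (ucf_functor (univt C)) (univt C');
  ucf_final : is_final (ucf_functor (uc_pt C));
  ucf_pullback : forall (X : C) (F : Hom X (univ C)),
    is_pullback (fmor ucf_functor (ext_p C F)) (fmor ucf_functor (ext_Q C F))
                (fmor ucf_functor F) (fmor ucf_functor (univ_p C));
  ucf_phi_pullback :
    is_pullback (fmor ucf_functor (univ_p C)) ucf_phit ucf_phi (univ_p C')
}.

Arguments ucf_phi {C C'} _.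
Arguments ucf_phit {C C'} _.
Arguments ucf_final {C C'} _.
Arguments ucf_pullback {C C'} _ {X} F.
Arguments ucf_phi_pullback {C C'} _.

(** The set [Ob_n] and the function [int] on it are defined by simultaneous
    recursion, hence packaged in a dependent pair. *)
Fixpoint Ob_int (C : universe_category) (n : nat) : {T : Type & T -> C} :=
  match n with
  | O => existT (fun T : Type => T -> C) unit (fun _ => uc_pt C)
  | S m =>
      existT (fun T : Type => T -> C)
        {A : projT1 (Ob_int C m) & Hom (projT2 (Ob_int C m) A) (univ C)}
        (fun AF => ext C (projT2 AF))
  end.

Definition Ob (C : universe_category) (n : nat) : Type := projT1 (Ob_int C n).

Definition int_n {C : universe_category} {n : nat} (A : Ob C n) : C :=
  projT2 (Ob_int C n) A.

Definition ob_pair {C : universe_category} {n : nat}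
    (A : Ob C n) (F : Hom (int_n A) (univ C)) : Ob C (S n) :=
  existT (fun A : Ob C n => Hom (int_n A) (univ C)) A F.

Definition CC_ob (C : universe_category) : Type := {n : nat & Ob C n}.

Definition int_ob {C : universe_category} (G : CC_ob C) : C := int_n (projT2 G).

(** Hom-types are indexed by source and target, so the morphisms of [C] between
    the underlying objects serve as their own copies. *)
Definition CC (C : universe_category) : category :=
  @Category (CC_ob C)
    (fun G' G => Hom (int_ob G') (int_ob G))
    (fun G => idm (int_ob G))
    (fun _ _ _ f g => f ;; g)
    (fun _ _ f => comp_id_l f)
    (fun _ _ f => comp_id_r f)
    (fun _ _ _ _ f g h => comp_assoc f g h).

Definition int (C : universe_category) : functor (CC C) C :=
  @Functor (CC C) C (@int_ob C) (fun _ _ f => f)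
    (fun _ => eq_refl) (fun _ _ _ _ _ => eq_refl).

Section Homomorphism.
Context {C C' : universe_category} (Phi : universe_category_functor C C').

Lemma ucf_ext_pullback (X : C) (F : Hom X (univ C)) :
  is_pullback (fmor Phi (ext_p C F)) (fmor Phi (ext_Q C F) ;; ucf_phit Phi)
              (fmor Phi F ;; ucf_phi Phi) (univ_p C').
Proof.
  exact (pullback_paste (ucf_pullback Phi F) (ucf_phi_pullback Phi)).
Qed.

Definition ucf_code (X : C) (F : Hom X (univ C)) (Y : C') (s : Hom Y (Phi X))
  : Hom Y (univ C') := s ;; fmor Phi F ;; ucf_phi Phi.

Lemma ucf_ext_map_unique (X : C) (F : Hom X (univ C))
    (Y : C') (s : Hom Y (Phi X)) :
  exists! t : Hom (ext C' (ucf_code F s)) (Phi (ext C F)),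
    t ;; fmor Phi (ext_p C F) = ext_p C' (ucf_code F s) ;; s /\
    t ;; (fmor Phi (ext_Q C F) ;; ucf_phit Phi) = ext_Q C' (ucf_code F s).
Proof.
  apply (proj2 (ucf_ext_pullback F)).
  rewrite <- (proj1 (ext_pullback C' (ucf_code F s))).
  unfold ucf_code. now rewrite !comp_assoc.
Qed.

Definition ucf_ext_map (X : C) (F : Hom X (univ C))
    (Y : C') (s : Hom Y (Phi X)) :
    Hom (ext C' (ucf_code F s)) (Phi (ext C F)) :=
  the (ucf_ext_map_unique F s).

Fixpoint H_psi (n : nat) :
    forall A : Ob C n, {B : Ob C' n & Hom (int_n B) (Phi (int_n A))} :=
  match n with
  | O => fun _ =>
      existT (fun B : Ob C' 0 => Hom (int_n B) (Phi (uc_pt C)))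
        tt (the (ucf_final Phi (uc_pt C')))
  | S m => fun AF =>
      let A := projT1 AF in
      let F := projT2 AF in
      let HA := projT1 (H_psi A) in
      let psiA := projT2 (H_psi A) in
      existT (fun B : Ob C' (S m) => Hom (int_n B) (Phi (ext C F)))
        (ob_pair (A := HA) (ucf_code F psiA)) (ucf_ext_map F psiA)
  end.

Definition H_n {n : nat} (A : Ob C n) : Ob C' n := projT1 (H_psi A).

Definition psi_n {n : nat} (A : Ob C n) : Hom (int_n (H_n A)) (Phi (int_n A)) :=
  projT2 (H_psi A).

Lemma H_n_pair (n : nat) (A : Ob C n) (F : Hom (int_n A) (univ C)) :
  H_n (ob_pair F) =
  ob_pair (A := H_n A) (psi_n A ;; fmor Phi F ;; ucf_phi Phi).
Proof. reflexivity. Qed.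

Lemma psi_n_pair_p (n : nat) (A : Ob C n) (F : Hom (int_n A) (univ C)) :
  psi_n (ob_pair F) ;; fmor Phi (ext_p C F) =
  ext_p C' (psi_n A ;; fmor Phi F ;; ucf_phi Phi) ;; psi_n A.
Proof. exact (proj1 (the_spec (ucf_ext_map_unique F (psi_n A)))). Qed.

Lemma psi_n_pair_Q (n : nat) (A : Ob C n) (F : Hom (int_n A) (univ C)) :
  psi_n (ob_pair F) ;; fmor Phi (ext_Q C F) ;; ucf_phit Phi =
  ext_Q C' (psi_n A ;; fmor Phi F ;; ucf_phi Phi).
Proof.
  rewrite <- comp_assoc.
  exact (proj2 (the_spec (ucf_ext_map_unique F (psi_n A)))).
Qed.

Lemma psi_n_iso (n : nat) (A : Ob C n) : is_iso (psi_n A).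
Proof.
  induction n as [|n IH].
  - destruct (uc_pt_final (Phi (uc_pt C))) as [g _].
    exists g; split.
    + destruct (uc_pt_final (uc_pt C')) as [u [_ Hu]].
      transitivity u; [symmetry|]; now apply Hu.
    + destruct (ucf_final Phi (Phi (uc_pt C))) as [u [_ Hu]].
      transitivity u; [symmetry|]; now apply Hu.
  - destruct A as [A F].
    apply (pullback_iso (i := psi_n A)
             (f' := ext_p C' (psi_n A ;; fmor Phi F ;; ucf_phi Phi))
             (g' := ext_Q C' (psi_n A ;; fmor Phi F ;; ucf_phi Phi))
             (f := fmor Phi (ext_p C F))
             (g := fmor Phi (ext_Q C F) ;; ucf_phit Phi)
             (h := fmor Phi F ;; ucf_phi Phi) (k := univ_p C')).
    + rewrite comp_assoc. apply ext_pullback.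
    + apply ucf_ext_pullback.
    + apply IH.
    + apply psi_n_pair_p.
    + rewrite comp_assoc. apply psi_n_pair_Q.
Qed.

Definition H_ob (G : CC C) : CC C' :=
  existT (fun n => Ob C' n) (projT1 G) (H_n (projT2 G)).

Definition psi (G : CC C) : Hom (int C' (H_ob G)) (Phi (int C G)) :=
  psi_n (projT2 G).

Lemma psi_iso (G : CC C) : is_iso (psi G).
Proof. apply psi_n_iso. Qed.

Definition H_mor (G' G : CC C) (f : Hom G' G) : Hom (H_ob G') (H_ob G) :=
  psi G' ;; fmor Phi (fmor (int C) f) ;; inverse (psi_iso G).

Lemma H_mor_id (G : CC C) : H_mor (idm G) = idm (H_ob G).
Proof.
  unfold H_mor.
  now rewrite !fmor_id, comp_id_r, comp_inverse.
Qed.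

Lemma H_mor_comp (G1 G2 G3 : CC C) (f : Hom G1 G2) (g : Hom G2 G3) :
  H_mor (f ;; g) = H_mor f ;; H_mor g.
Proof.
  unfold H_mor; simpl.
  rewrite fmor_comp, !comp_assoc.
  rewrite <- (comp_assoc _ (inverse (psi_iso G2)) (psi G2)).
  now rewrite inverse_comp, comp_id_r.
Qed.

Definition H : functor (CC C) (CC C') :=
  @Functor (CC C) (CC C') H_ob H_mor H_mor_id H_mor_comp.

End Homomorphism.

(* Main.v *)
Require Import Defs.

Theorem lemma3p14 (C C' : universe_category)
    (Phi : universe_category_functor C C') :
  is_nat_iso (comp_functor (H Phi) (int C')) (comp_functor (int C) Phi)
    (psi Phi).
Proof.
  split.
  - (* [H] acts on morphisms by conjugation with [psi], so the naturality
       square only asks that the trailing inverse cancel. *)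
    intros G' G f.
    change (psi Phi G' ;; fmor Phi (fmor (int C) f) ;; inverse (psi_iso Phi G)
              ;; psi Phi G = psi Phi G' ;; fmor Phi (fmor (int C) f)).
    now rewrite <- comp_assoc, inverse_comp, comp_id_r.
  - exact (psi_iso Phi).
Qed.
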